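(* For every integer $n\ge 6$, the maximum number of triples in a triple system on $n$ vertices that contains no Berge-$K_4$ is $$\mathrm{ex}_3(n,\mathcal{B})=f(n)=\left\lfloor\frac{n}{3}\right\rfloor\left\lfloor\frac{n+1}{3}\right\rfloor\left\lfloor\frac{n+2}{3}\right\rfloor,$$ which equals the number of triples of the balanced complete $3$-partite triple system on $n$ vertices (all triples $\{a,b,c\}$ with $a\in A,b\in B,c\in C$ for a partition $A,B,C$ of the $n$ vertices with $\lfloor n/3\rfloor=|A|\le|B|\le|C|=\lceil n/3\rceil$).
   Context: A triple system is a $3$-uniform hypergraph, i.e. a set $V$ of vertices together with a set of $3$-element subsets of $V$ (triples). A Berge-$K_4$ in a triple system is a configuration consisting of four distinct vertices $v_1,v_2,v_3,v_4$ and six distinct triples $e_{ij}$ ($1\le i<j\le 4$) of the system such that $\{v_i,v_j\}\subset e_{ij}$ for every $1\le i<j\le 4$. $\mathcal{B}$ denotes the family of all Berge-$K_4$ configurations. A triple system is $\mathcal{B}$-free if it contains no Berge-$K_4$. $\mathrm{ex}_3(n,\mathcal{F})$ denotes the maximum number of triples in a triple system on $n$ vertices containing no member of the family $\mathcal{F}$ as a subhypergraph. *)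

(* Defs.v *)
From mathcomp Require Import all_boot.
Set Implicit Arguments. Unset Strict Implicit. Unset Printing Implicit Defensive.

Definition triple_system (n : nat) (H : {set {set 'I_n}}) : Prop :=
  forall e, e \in H -> #|e| = 3.

Definition has_berge_K4 (n : nat) (H : {set {set 'I_n}}) : Prop :=
  exists (v : 'I_4 -> 'I_n) (e : 'I_4 -> 'I_4 -> {set 'I_n}),
    injective v /\
    (forall i j : 'I_4, i < j -> [/\ e i j \in H, v i \in e i j & v j \in e i j]) /\
    (forall i j k l : 'I_4, i < j -> k < l -> e i j = e k l -> i = k /\ j = l).

Definition berge_free (n : nat) (H : {set {set 'I_n}}) : Prop := ~ has_berge_K4 H.

Definition f (n : nat) : nat := (n %/ 3) * ((n + 1) %/ 3) * ((n + 2) %/ 3).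

Definition is_ex3_berge_K4 (n m : nat) : Prop :=
  (exists H : {set {set 'I_n}}, [/\ triple_system H, berge_free H & #|H| = m]) /\
  (forall H : {set {set 'I_n}}, triple_system H -> berge_free H -> #|H| <= m).

(* Balanced partition of 'I_n: A = [0, n/3), B = [n/3, n/3 + (n+1)/3), C = rest;
   sizes floor(n/3) <= floor((n+1)/3) <= floor((n+2)/3) = ceil(n/3). *)
Definition partA (n : nat) : {set 'I_n} := [set i : 'I_n | i < n %/ 3].
Definition partB (n : nat) : {set 'I_n} :=
  [set i : 'I_n | (n %/ 3 <= i) && (i < n %/ 3 + (n + 1) %/ 3)].
Definition partC (n : nat) : {set 'I_n} :=
  [set i : 'I_n | n %/ 3 + (n + 1) %/ 3 <= i].

Definition balanced_3partite (n : nat) : {set {set 'I_n}} :=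
  [set e : {set 'I_n} | [exists a in partA n, exists b in partB n,
      exists c in partC n, e == [set a; b; c]]].

(* Main.v *)
(* For n >= 9 consider the bipartite graph between the triples of a Berge-K4-free
   system H and the pairs they contain. Hall's theorem gives X in H such that the
   set R of pairs covered by X is matched into X, while H - X is matched into a
   set B of pairs outside R. Distinct representatives make the graph R + B
   K4-free, so with R red and B blue, |H| is at most the number of red triangles
   plus the number of blue edges. If there is no red triangle this is at most
   n^2/3 <= f(n). Otherwise remove a red triangle: every other vertex has at most
   two neighbours in it, every red edge at most one common red neighbour in it,
   and the bounds m^2/3 on edges and f(m) on triangles of K4-free graphs on
   m = n - 3 >= 6 vertices combine to f(m) + m^2/3 + m + 1 = f(n).

   For n = 6, 7, 8 a system with f(n) + 1 triples is refuted by exhaustive search.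
   Ordering the vertices so that the last one always has minimum degree in the
   induced subsystem gives lower bounds on the number of triples among the first
   k vertices, which keep the search small. *)
Require Import Defs.
From mathcomp Require Import all_boot.
From mathcomp Require Import zify.
Set Implicit Arguments. Unset Strict Implicit. Unset Printing Implicit Defensive.

(** * Hall's theorem *)

Definition nbhd (T U : finType) (N : T -> {set U}) (B : {set T}) : {set U} :=
  \bigcup_(x in B) N x.

Lemma nbhdU (T U : finType) (N : T -> {set U}) (B C : {set T}) :
  nbhd N (B :|: C) = nbhd N B :|: nbhd (fun z => N z :\: nbhd N B) C.
Proof.
apply/setP=> u; rewrite !inE; apply/bigcupP/orP.
  move=> [z]; rewrite inE => /orP[zB uz|zC uz].
    by left; apply/bigcupP; exists z.
  have [uB|uB] := boolP (u \in nbhd N B); first by left.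
  by right; apply/bigcupP; exists z => //; rewrite inE uB.
move=> [/bigcupP[z zB uz]|/bigcupP[z zC]].
  by exists z; rewrite ?inE ?zB.
by rewrite inE => /andP[_ uz]; exists z; rewrite ?inE ?zC ?orbT.
Qed.

Lemma subsetD_disjoint (T : finType) (A B C : {set T}) :
  C \subset A :\: B -> [disjoint B & C].
Proof.
move=> CD; rewrite disjoint_sym; apply: disjointWl CD _.
by rewrite -setI_eq0 setDE -setIA [~: B :&: B]setIC setICr setI0.
Qed.

(** Induction on the size of [A], after Halmos and Vaughan: either some proper nonempty subset is
    tight, or all of them have a spare neighbour. The point [u0] supplies the map when [A] is
    empty. *)
Lemma Hall (T U : finType) (u0 : U) (N : T -> {set U}) (A : {set T}) :
  (forall B : {set T}, B \subset A -> #|B| <= #|nbhd N B|) ->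
  exists phi : T -> U, {in A &, injective phi} /\ {in A, forall x, phi x \in N x}.
Proof.
have [k] := ubnP #|A|; elim: k A N => // k IH A N leAk hallA.
have [->|[x xA]] := set_0Vmem A.
  by exists (fun=> u0); split=> [? ?|?]; rewrite inE.
have glue (C : {set T}) (N1 N2 : T -> {set U}) (phi1 phi2 : T -> U) :
    {in C &, injective phi1} -> {in C, forall z, phi1 z \in N1 z} ->
    {in A :\: C &, injective phi2} -> {in A :\: C, forall z, phi2 z \in N2 z} ->
    (forall z, N1 z \subset N z) -> (forall z, N2 z \subset N z) ->
    (forall y z, y \in C -> z \in A :\: C -> [disjoint N1 y & N2 z]) ->
    exists phi : T -> U, {in A &, injective phi} /\ {in A, forall x, phi x \in N x}.
  move=> i1 m1 i2 m2 s1 s2 d12; exists (fun z => if z \in C then phi1 z else phi2 z).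
  have dis y z : y \in C -> z \in A :\: C -> phi1 y <> phi2 z.
    move=> yC zD eyz; have /pred0P/(_ (phi1 y)) := d12 y z yC zD.
    by rewrite /= m1 // eyz m2.
  split=> [y z yA zA|z zA].
    case: ifPn => yC; case: ifPn => zC.
    - exact: i1.
    - by move/dis; rewrite inE zC zA => /(_ yC isT).
    - by move/esym/dis; rewrite inE yC yA => /(_ zC isT).
    - by apply: i2; rewrite inE ?yC ?zC.
  case: ifPn => zC; first exact: (subsetP (s1 z)) (m1 z zC).
  by apply: (subsetP (s2 z)) (m2 z _); rewrite inE zC.
(* A tight [B] is matched on its own. Hall's condition survives on [A :\: B] once [nbhd N B] is
   removed, because [B :|: C] has at least [#|B| + #|C|] neighbours. *)
have [/existsP[B /and4P[BA B0 BneA /eqP cB]]|noB] :=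
    boolP [exists B : {set T}, [&& B \subset A, B != set0, B != A & #|nbhd N B| == #|B|]].
  have ltB : #|B| < #|A| by apply: proper_card; rewrite properEneq BneA.
  have [phi1 [i1 m1]] : exists phi : T -> U,
      {in B &, injective phi} /\ {in B, forall x, phi x \in N x}.
    apply: IH; first lia.
    by move=> C CB; apply: hallA; apply: subset_trans BA.
  have [phi2 [i2 m2]] : exists phi : T -> U, {in A :\: B &, injective phi} /\
      {in A :\: B, forall x, phi x \in N x :\: nbhd N B}.
    apply: IH.
      have := cardsID B A; rewrite (setIidPr BA).
      by move: B0; rewrite -card_gt0; lia.
    move=> C CD; have dCB := subsetD_disjoint CD.
    have := hallA (B :|: C); rewrite subUset BA (subset_trans CD (subsetDl _ _)).
    move=> /(_ isT); rewrite cardsU (disjoint_setI0 dCB) cards0 subn0.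
    rewrite nbhdU cardsU; move: cB; lia.
  apply: (glue B N _ phi1 phi2 i1 m1 i2 m2) => //.
    by move=> z; apply: subsetDl.
  move=> y z yB _; rewrite disjoint_sym -setI_eq0; apply/eqP/setP=> u.
  rewrite !inE; apply/negbTE/negP=> /andP[/andP[/negP uB _] uy].
  by apply: uB; apply/bigcupP; exists y.
(* Without tight subsets [x] may take any neighbour [y]: removing [y] costs each subset at most its
   spare neighbour. *)
have [y yx] : exists y, y \in N x.
  apply/set0Pn; rewrite -card_gt0.
  by have := hallA [set x]; rewrite sub1set xA cards1 /nbhd big_set1; apply.
have [phi2 [i2 m2]] : exists phi : T -> U, {in A :\: [set x] &, injective phi} /\
    {in A :\: [set x], forall z, phi z \in N z :\ y}.
  apply: IH; first by have := cardsD1 x A; rewrite xA; lia.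
  move=> C CD; have [->|C0] := eqVneq C set0; first by rewrite cards0.
  have CA : C \subset A := subset_trans CD (subsetDl _ _).
  have CneA : C != A.
    by apply/eqP=> eCA; move: CD; rewrite eCA => /subsetP/(_ x xA); rewrite !inE eqxx.
  have lt : #|C| < #|nbhd N C|.
    rewrite ltn_neqAle hallA // andbT eq_sym.
    by move/existsPn: noB => /(_ C); rewrite CA C0 CneA.
  have -> : nbhd (fun z => N z :\ y) C = nbhd N C :\ y.
    apply/setP=> u; rewrite !inE; apply/bigcupP/andP.
      by move=> [z zC]; rewrite !inE => /andP[uy uz]; split=> //; apply/bigcupP; exists z.
    by move=> [uy /bigcupP[z zC uz]]; exists z => //; rewrite !inE uy.
  by have := cardsD1 y (nbhd N C); lia.
apply: (glue [set x] (fun z => if z == x then [set y] else set0) _ (fun=> y) phi2 _ _ i2 m2).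
- by move=> a b; rewrite !inE => /eqP-> /eqP->.
- by move=> z; rewrite inE => /eqP->; rewrite eqxx inE.
- by move=> z; case: eqP => [->|]; rewrite ?sub1set ?sub0set.
- by move=> z; apply: subsetDl.
move=> a z; rewrite inE => /eqP-> _; rewrite eqxx disjoint_sym -setI_eq0.
by apply/eqP/setP=> u; rewrite !inE; case: (u == y); rewrite ?andbF.
Qed.

(* [X] is chosen to maximize the deficiency [#|X| - #|nbhd N X|]; both Hall
   conditions are instances of this maximality. *)
Lemma Hall_split (T U : finType) (u0 : U) (t0 : T) (N : T -> {set U}) (A : {set T}) :
  exists X : {set T}, [/\ X \subset A,
    exists phi : T -> U, {in A :\: X &, injective phi} /\
      {in A :\: X, forall x, phi x \in N x :\: nbhd N X} &
    exists psi : U -> T, {in nbhd N X &, injective psi} /\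
      {in nbhd N X, forall u, psi u \in X /\ u \in N (psi u)}].
Proof.
(* The deficiency shifted by [#|U|], which avoids truncated subtraction. *)
pose F (X : {set T}) := #|X| + #|~: nbhd N X|.
have [X XA maxX] := @arg_maxnP _ set0 (fun X : {set T} => X \subset A) F (sub0set A).
have cN B : #|nbhd N B| + #|~: nbhd N B| = #|U| by rewrite cardsC.
exists X; split=> //.
  apply: (Hall u0) => Y YD; have YX := subsetD_disjoint YD.
  have XYA : X :|: Y \subset A by rewrite subUset XA (subset_trans YD (subsetDl _ _)).
  have := maxX _ XYA; rewrite /F cardsU (disjoint_setI0 YX) cards0 subn0.
  rewrite nbhdU.
  have := cardsC (nbhd N X); have := cardsC (nbhd N X :|: nbhd (fun z => N z :\: nbhd N X) Y).
  rewrite cardsU; lia.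
have [|psi [ipsi mpsi]] := @Hall U T t0 (fun u => [set x in X | u \in N x]) (nbhd N X).
  (* Deleting from [X] every element with a neighbour in [Q] removes all of [Q] from the
     neighbourhood; by maximality at least [#|Q|] elements are deleted. *)
  move=> Q QN; pose X' := X :\: nbhd (fun u => [set x in X | u \in N x]) Q.
  have X'A : X' \subset A by apply: subset_trans (subsetDl _ _) XA.
  have := maxX _ X'A; rewrite /F.
  have sub : nbhd N X' \subset nbhd N X :\: Q.
    apply/subsetP=> u /bigcupP[x]; rewrite inE => /andP[xQ xX] ux; rewrite inE.
    apply/andP; split; last by apply/bigcupP; exists x.
    by apply: contra xQ => uQ; apply/bigcupP; exists u; rewrite ?inE ?xX.
  have := subset_leq_card sub; rewrite cardsD (setIidPr QN).
  have := subset_leq_card QN.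
  have := cardsC (nbhd N X); have := cardsC (nbhd N X').
  have sX : nbhd (fun u => [set x in X | u \in N x]) Q \subset X.
    by apply/bigcupsP=> u _; apply/subsetP=> x; rewrite inE => /andP[].
  have := subset_leq_card sX.
  rewrite /X' cardsD (setIidPr sX); lia.
exists psi; split=> // u uN; have := mpsi u uN.
by rewrite inE => /andP.
Qed.

(** * Edges and triangles of K4-free graphs *)

(** Adding a vertex to each of three balanced classes of sizes a, b, c adds ab+bc+ca, a+b+c and 1 to
    the product abc, and ab+bc+ca is the floor of m^2/3. This is the gain allowed when a triangle is
    removed from a graph. *)
Lemma f_add3 m : f (m + 3) = f m + m * m %/ 3 + m + 1.
Proof.
rewrite /f.
have -> : (m + 3) %/ 3 = m %/ 3 + 1 by lia.
have -> : (m + 3 + 1) %/ 3 = (m + 1) %/ 3 + 1 by lia.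
have -> : (m + 3 + 2) %/ 3 = (m + 2) %/ 3 + 1 by lia.
have : m %% 3 < 3 by rewrite ltn_mod.
have em := divn_eq m 3; set k := m %/ 3 in em *; set j := m %% 3 in em *.
have -> : (m + 1) %/ 3 = k + (j == 2) by rewrite em; case: j em => [|[|[|j]]]; lia.
have -> : (m + 2) %/ 3 = k + (0 < j) by rewrite em; case: j em => [|[|[|j]]]; lia.
have -> : m * m %/ 3 = 3 * k * k + 2 * k * j + (j == 2).
  rewrite em; have -> : (k * 3 + j) * (k * 3 + j) = (3 * k * k + 2 * k * j) * 3 + j * j by nia.
  by rewrite divnMDl //; case: j em => [|[|[|j]]] //=; lia.
rewrite em; case: j em => [|[|[|j]]] //=; nia.
Qed.

Lemma f_gt n : 6 <= n -> n <= f n.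
Proof.
elim/ltn_ind: n => n IH n6.
have [n9|n9] := leqP 9 n.
  have -> : n = n - 3 + 3 by lia.
  rewrite f_add3; have := IH (n - 3) ltac:(lia) ltac:(lia).
  have : 2 <= (n - 3) * (n - 3) %/ 3 by rewrite leq_divRL //; nia.
  lia.
by case: n n6 n9 {IH} => [|[|[|[|[|[|[|[|[|n]]]]]]]]].
Qed.

(** Pays for the deletion of one vertex in [triangles6_at_le]. The maximum with [n] is taken because
    [f] vanishes at 0, 1 and 2 and stays below [n] up to 5. *)
Lemma f_step n : maxn (f n) n < maxn (f n.+1) n.+1.
Proof.
suff: f n < maxn (f n.+1) n.+1 by lia.
elim/ltn_ind: n => n IH.
have [n3|n3] := leqP 3 n; last by case: n n3 {IH} => [|[|[|n]]].
have [n6|n6] := leqP 6 n; last by case: n n3 n6 {IH} => [|[|[|[|[|[|n]]]]]].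
have IH3 := IH (n - 3) ltac:(lia).
have -> : f n.+1 = f (n - 3 + 1 + 3) by congr f; lia.
have -> : f n = f (n - 3 + 3) by congr f; lia.
rewrite !f_add3.
have : n - 3 <= 5 \/ f (n - 3) < f (n - 3 + 1).
  have [|n6'] := leqP 6 (n - 3).
    by move=> n6'; right; have := @f_gt (n - 3).+1 ltac:(lia); move: IH3; rewrite addn1; lia.
  by left; lia.
have le : (n - 3) * (n - 3) %/ 3 <= (n - 3 + 1) * (n - 3 + 1) %/ 3.
  by apply: leq_div2r; nia.
case=> [n5|]; last by lia.
have : n <= 8 by lia.
by case: n n3 n6 {IH IH3 le n5} => [|[|[|[|[|[|[|[|[|n]]]]]]]]].
Qed.

(** Both sides equal 27 at [n = 9], while at [n = 8] the inequality fails (21 against 18); hence the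
    separate treatment of small [n]. *)
Lemma f_ge_turan n : 9 <= n -> n * n %/ 3 <= f n.
Proof.
elim/ltn_ind: n => n IH n9.
have [n12|n12] := leqP 12 n.
  have := IH (n - 3) ltac:(lia) ltac:(lia).
  have -> : f n = f (n - 3 + 3) by congr f; lia.
  rewrite f_add3; set m := n - 3 => IHm; have -> : n = m + 3 by lia.
  have -> : (m + 3) * (m + 3) = (m + m + 3) * 3 + m * m by nia.
  have : 9 * m <= m * m by rewrite leq_mul2r; apply/orP; right; lia.
  by rewrite divnMDl //; lia.
by case: n n9 n12 {IH} => [|[|[|[|[|[|[|[|[|[|[|[|n]]]]]]]]]]]].
Qed.

Section Counting.
Variable V : finType.
Implicit Types (g r b : rel V) (W S : {set V}).

(* Sums over ordered tuples: [edges2] is twice the number of edges inside [W]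
   and [triangles6] six times the number of triangles. *)
Definition edges2 g W := \sum_(x in W) \sum_(y in W) g x y.
Definition triangles6 g W :=
  \sum_(x in W) \sum_(y in W) \sum_(z in W) [&& g x y, g y z & g x z].

(** For irreflexive [g], adjacency already forces the four vertices to be distinct. *)
Definition K4_free g := forall x y z t,
  ~~ [&& g x y, g x z, g x t, g y z, g y t & g z t].

Lemma sum_setD S W (F : V -> nat) : S \subset W ->
  \sum_(x in W) F x = \sum_(x in S) F x + \sum_(x in W :\: S) F x.
Proof. by move=> SW; rewrite (big_setID S) (setIidPr SW). Qed.

Lemma sum_set3 (a b c : V) (F : V -> nat) : a != b -> a != c -> b != c ->
  \sum_(x in [set a; b; c]) F x = F a + F b + F c.
Proof.
move=> ab ac bc; rewrite setUC big_setU1 ?inE /=; last first.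
  by rewrite negb_or ![c == _]eq_sym ac bc.
by rewrite big_setU1 ?inE //= big_set1 addnC.
Qed.

Lemma edges2_setD g S W : symmetric g -> S \subset W ->
  edges2 g W = edges2 g S + 2 * (\sum_(z in W :\: S) \sum_(x in S) g z x)
    + edges2 g (W :\: S).
Proof.
move=> gC SW; rewrite /edges2 (sum_setD _ SW).
under eq_bigr => x _ do rewrite (sum_setD _ SW).
under [X in _ + X = _]eq_bigr => x _ do rewrite (sum_setD _ SW).
rewrite !big_split /= [\sum_(i in S) \sum_(j in W :\: S) _]exchange_big /=.
under [X in _ + X + _ = _]eq_bigr => x _ do under eq_bigr => y _ do rewrite gC.
lia.
Qed.

(** Ordered triples are sorted by the coordinates that lie in [S]; each factor 3 is the position of
    the coordinate that is alone on its side. *)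
Lemma triangles6_setD g S W : symmetric g -> S \subset W ->
  triangles6 g W = triangles6 g S
    + 3 * (\sum_(z in W :\: S) \sum_(x in S) \sum_(y in S) [&& g x y, g z x & g z y])
    + 3 * (\sum_(y in W :\: S) \sum_(z in W :\: S) \sum_(x in S) [&& g y z, g y x & g z x])
    + triangles6 g (W :\: S).
Proof.
move=> gC SW.
pose t x y z : nat := [&& g x y, g y z & g x z].
pose G (A B C : {set V}) := \sum_(x in A) \sum_(y in B) \sum_(z in C) t x y z.
have G1 B C : G W B C = G S B C + G (W :\: S) B C by rewrite /G (sum_setD _ SW).
have G12 A B C : G A B C = G B A C.
  rewrite /G exchange_big; apply: eq_bigr => x _; apply: eq_bigr => y _.
  apply: eq_bigr => z _; rewrite /t [g y x]gC; congr nat_of_bool.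
  by case: (g x y); case: (g x z); case: (g y z).
have G23 A B C : G A B C = G A C B.
  rewrite /G; apply: eq_bigr => x _; rewrite exchange_big; apply: eq_bigr => y _.
  apply: eq_bigr => z _; rewrite /t [g z y]gC; congr nat_of_bool.
  by case: (g x y); case: (g x z); case: (g y z).
have -> : triangles6 g W = G W W W by [].
have -> : triangles6 g S = G S S S by [].
have -> : triangles6 g (W :\: S) = G (W :\: S) (W :\: S) (W :\: S) by [].
have -> : \sum_(z in W :\: S) \sum_(x in S) \sum_(y in S) [&& g x y, g z x & g z y]
    = G (W :\: S) S S.
  apply: eq_bigr => z _; apply: eq_bigr => x _; apply: eq_bigr => y _.
  by rewrite /t; case: (g x y); case: (g z x); case: (g z y).
have -> : \sum_(y in W :\: S) \sum_(z in W :\: S) \sum_(x in S) [&& g y z, g y x & g z x]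
    = G (W :\: S) (W :\: S) S.
  apply: eq_bigr => z _; apply: eq_bigr => x _; apply: eq_bigr => y _.
  by rewrite /t; case: (g z x); case: (g z y); case: (g x y).
set D := W :\: S.
(* Splitting every coordinate gives eight sums, and the symmetries of [G] identify those with
   equally many coordinates in [S]; the rest is linear. *)
have e1 := G1 W W; have e2 := G1 S W; have e3 := G1 D W; have e4 := G1 S S.
have e5 := G1 D D; have e6 := G1 S D.
have := G12 S W W; have := G23 W S W; have := G12 D W W; have := G12 S W S.
have := G12 D W D; have := G23 S D W; have := G12 S D W; have := G23 D S W.
have := G23 S S W; have := G12 S W S; have := G12 D W S; have := G23 D D W.
have := G23 S S D; have := G12 S D S; have := G23 D D S; have := G12 D S D.
have := G23 S W D; have := G12 S W D; have := G12 D S S; have := G23 D S S.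
move: e1 e2 e3 e4 e5 e6; rewrite -/D; lia.
Qed.

Lemma edges2_le g W : symmetric g -> irreflexive g -> K4_free g ->
  edges2 g W <= 2 * (#|W| * #|W| %/ 3).
Proof.
(* Rounding down is harmless because a square is never 2 modulo 3. *)
move=> gC gI gK; suff: 3 * edges2 g W <= 2 * (#|W| * #|W|).
  have := divn_eq (#|W| * #|W|) 3.
  have -> : (#|W| * #|W|) %% 3 = (#|W| %% 3) * (#|W| %% 3) %% 3 by rewrite modnMm.
  have : #|W| %% 3 < 3 by rewrite ltn_mod.
  case: (#|W| %% 3) => [|[|[|k]]] //= _; lia.
have [k] := ubnP #|W|; elim: k W => // k IH W leW.
(* Induction by removing a maximum clique [S], which has at most 3 vertices. *)
pose P S := [&& S \subset W & [forall x in S, forall y in S, (x != y) ==> g x y]].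
have P0 : P set0 by rewrite /P sub0set; apply/forall_inP=> x; rewrite inE.
have [S /andP[SW /forall_inP Scl] maxS] := @arg_maxnP _ set0 P (fun S => #|S|) P0.
have {}Scl x y : x \in S -> y \in S -> x != y -> g x y.
  by move=> xS yS xy; have /forall_inP/(_ y yS)/implyP := Scl x xS; apply.
have S3 : #|S| <= 3.
  rewrite leqNgt; apply/negP=> S4.
  have /card_geqP[s [us ss sS]] := S4.
  case: s us ss sS => [|x [|y [|z [|t [|? ?]]]]] //= us _ sS.
  have := gK x y z t; rewrite !Scl ?sS ?inE ?eqxx ?orbT //;
    by apply: contraTneq us => ->; rewrite /= !inE eqxx ?orbT ?andbF.
(* A vertex adjacent to all of [S] would enlarge the clique. *)
have dS z : z \in W :\: S -> \sum_(x in S) g z x < #|S| \/ #|S| = 0.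
  rewrite inE => /andP[zS zW].
  have [all1|] := boolP [forall x in S, g z x].
    suff /maxS : P (z |: S) by rewrite /= cardsU1 zS add1n ltnn.
    rewrite /P subUset sub1set zW SW /=; apply/forall_inP=> x xS.
    apply/forall_inP=> y yS; apply/implyP=> xy.
    have /forall_inP gz := all1.
    move: xS yS xy; rewrite !inE => /orP[/eqP->|xS] /orP[/eqP->|yS]; rewrite ?eqxx //.
    - by rewrite gz.
    - by rewrite gC gz.
    - exact: Scl.
  rewrite negb_forall => /existsP[x]; rewrite negb_imply => /andP[xS /negbTE gx].
  left; rewrite (big_setD1 x) //= gx add0n.
  rewrite (cardsD1 x) xS add1n ltnS -sum1_card; apply: leq_sum => y _.
  by case: (g z y).
have eS : edges2 g S <= #|S| * (#|S| - 1).
  rewrite /edges2 -sum_nat_const; apply: leq_sum => x xS.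
  rewrite (big_setD1 x) //= gI add0n [#|S|](cardsD1 x) xS addKn -sum1_card.
  by apply: leq_sum => y _; case: (g x y).
have [S0|S0] := posnP #|S|.
  suff -> : edges2 g W = 0 by rewrite muln0.
  rewrite /edges2 big1 // => x xW.
  have /maxS : P [set x].
    rewrite /P sub1set xW; apply/forall_inP=> y; rewrite inE => /eqP->.
    by apply/forall_inP=> z; rewrite inE => /eqP->; rewrite eqxx.
  by rewrite /= cards1 S0.
rewrite (edges2_setD gC SW).
have cW : #|W| = #|S| + #|W :\: S| by rewrite -[LHS](cardsID S) (setIidPr SW).
have := IH (W :\: S) ltac:(lia).
have : \sum_(z in W :\: S) \sum_(x in S) g z x <= #|W :\: S| * (#|S| - 1).
  rewrite -sum_nat_const; apply: leq_sum => z /dS; lia.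
move: cW S0 S3 eS.
case: #|S| => [|[|[|[|k']]]] // cW _ _; rewrite cW; nia.
Qed.

Definition edges2_at S r W :=
  \sum_(y in W) \sum_(z in W) (r y z && ((y \in S) || (z \in S))).

(* [S] consists of the vertices with two blue edges to the red triangle [T];
   these have no red edge to [T], so no red edge at [S] extends to a red
   triangle with a vertex in [T]. *)
Lemma red_triangle_split r b W t1 t2 t3 (T := [set t1; t2; t3]) (D := W :\: T)
    (S := [set z | \sum_(x in T) b z x == 2]) :
    symmetric r -> symmetric b -> irreflexive r -> irreflexive b ->
    (forall x y, ~~ (r x y && b x y)) -> K4_free (fun x y => r x y || b x y) ->
    T \subset W -> r t1 t2 -> r t1 t3 -> r t2 t3 ->
  triangles6 r W + 3 * edges2 b W + 3 * edges2_at S r D <=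
    6 + 6 * #|D| + 6 * #|D :&: S| + 3 * edges2 (fun x y => r x y || b x y) D
      + triangles6 r D.
Proof.
move=> rC bC rI bI rb gK TW r12 r13 r23.
have neq x y : r x y -> x != y by apply: contraTneq => ->; rewrite rI.
have sT F : \sum_(x in T) F x = F t1 + F t2 + F t3 by rewrite sum_set3 // neq.
have b12 : b t1 t2 = false by apply/negP=> h; have := rb t1 t2; rewrite r12 h.
have b13 : b t1 t3 = false by apply/negP=> h; have := rb t1 t3; rewrite r13 h.
have b23 : b t2 t3 = false by apply/negP=> h; have := rb t2 t3; rewrite r23 h.
have r21 : r t2 t1 by rewrite rC.
have r31 : r t3 t1 by rewrite rC.
have r32 : r t3 t2 by rewrite rC.
rewrite (triangles6_setD rC TW) (edges2_setD bC TW) -/D.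
have -> : edges2 b T = 0.
  by rewrite /edges2 !sT !bI b12 b13 b23 ![b _ t1]bC [b t3 t2]bC b12 b13 b23.
have -> : triangles6 r T = 6.
  by rewrite /triangles6 !sT !rI r12 r13 r23 r21 r31 r32.
have nK z : (r z t1 || b z t1) && (r z t2 || b z t2) && (r z t3 || b z t3) = false.
  by apply/negbTE; have := gK z t1 t2 t3; rewrite r12 r13 r23 /= andbT -!andbA.
(* Each [z] has at most two neighbours in [T]. Two red edges close one red triangle and count 6, one
   blue edge counts 6, and two blue edges count 12, but then [z] is in [S]. *)
have outT : 3 * (\sum_(z in D) \sum_(x in T) \sum_(y in T) [&& r x y, r z x & r z y])
    + 6 * (\sum_(z in D) \sum_(x in T) b z x) <= 6 * #|D| + 6 * #|D :&: S|.
  have -> : #|D :&: S| = \sum_(z in D) (z \in S).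
    by rewrite -sum1_card big_mkcond [RHS]big_mkcond; apply: eq_bigr => z _;
      rewrite inE; case: (z \in D); case: (z \in S).
  rewrite -sum1_card !big_distrr /= -!big_split; apply: leq_sum => z _.
  rewrite inE !sT !rI r12 r13 r23 r21 r31 r32 /=.
  move: (rb z t1) (rb z t2) (rb z t3) (nK z).
  by case: (r z t1); case: (r z t2); case: (r z t3);
    case: (b z t1); case: (b z t2); case: (b z t3).
have inS y x : y \in S -> x \in T -> r y x = false.
  rewrite inE sT => yS; rewrite !inE -orbA => xT.
  have [e1 e2 e3] : [/\ r y t1 = false, r y t2 = false & r y t3 = false].
    move: (rb y t1) (rb y t2) (rb y t3) (nK y) yS.
    by case: (r y t1); case: (r y t2); case: (r y t3);
      case: (b y t1); case: (b y t2); case: (b y t3).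
  by case/or3P: xT => /eqP->.
(* Two common red neighbours in [T] of a red edge would complete a K4. *)
have common y z : r y z ->
    [/\ r y t1 && r z t1 -> r y t2 && r z t2 = false,
        r y t1 && r z t1 -> r y t3 && r z t3 = false &
        r y t2 && r z t2 -> r y t3 && r z t3 = false].
  move=> yz; have K u v : r u v -> r y u && r z u -> r y v && r z v = false.
    move=> uv /andP[yu zu]; apply/negbTE.
    by have := gK y z u v; rewrite yz yu zu uv /= andbT; case: (r y v); case: (r z v).
  by split; apply: K.
(* Compared pair by pair: a red edge of [D] pays either for its single triangle with [T] or for its
   meeting [S], and a blue edge pays for itself. *)
have outD : 3 * (\sum_(y in D) \sum_(z in D) \sum_(x in T) [&& r y z, r y x & r z x])
    + 3 * edges2_at S r D + 3 * edges2 b D <= 3 * edges2 (fun x y => r x y || b x y) D.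
  rewrite -!mulnDr leq_mul2l /= /edges2 /edges2_at -!big_split /=; apply: leq_sum => y _.
  rewrite -!big_split /=; apply: leq_sum => z _; rewrite !sT.
  case ryz: (r y z) => //=; have -> : b y z = false.
    by apply/negP=> h; have := rb y z; rewrite ryz h.
  have t1T : t1 \in T by rewrite !inE eqxx.
  have t2T : t2 \in T by rewrite !inE eqxx ?orbT.
  have t3T : t3 \in T by rewrite !inE eqxx ?orbT.
  case yS: (y \in S); first by rewrite !(inS y).
  case zS: (z \in S); first by rewrite !(inS z) // !andbF.
  have [] := common _ _ ryz.
  case: (r y t1 && r z t1) => [/(_ isT)-> /(_ isT)->|] // _ _.
  by case: (r y t2 && r z t2) => [/(_ isT)->|] //; case: (_ && _).
lia.
Qed.

Lemma triangles6_le r W : symmetric r -> irreflexive r -> K4_free r ->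
  triangles6 r W <= 6 * f #|W|.
Proof.
move=> rC rI rK; have [k] := ubnP #|W|; elim: k W => // k IH W leW.
have [|none] := boolP [exists x in W, exists y in W, exists z in W,
    [&& r x y, r y z & r x z]].
  move=> /exists_inP[x xW /exists_inP[y yW /exists_inP[z zW /and3P[xy yz xz]]]].
  pose T := [set x; y; z].
  have neq u v : r u v -> u != v by apply: contraTneq => ->; rewrite rI.
  have cT : #|T| = 3 by rewrite /T setUC cardsU1 cards2 !inE !(eq_sym z) negb_or !neq.
  have TW : T \subset W.
    by apply/subsetP=> u; rewrite !inE -orbA => /or3P[] /eqP->.
  have cW : #|W| = 3 + #|W :\: T| by rewrite -cT -[LHS](cardsID T) (setIidPr TW).
  have b0 : K4_free (fun u v => r u v || false).
    by move=> u v w t; rewrite !orbF; apply: rK.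
  (* Without blue edges [S] is empty, and the estimate has exactly the shape of [f_add3]. *)
  have := @red_triangle_split r (fun _ _ => false) W x y z rC (fun _ _ => erefl)
    rI (fun _ => erefl) (fun _ _ => ltac:(by rewrite andbF)) b0 TW xy xz yz.
  rewrite -/T; have -> : [set z | \sum_(x in T) false == 2] = set0 :> {set V}.
    by apply/setP=> u; rewrite !inE big1.
  rewrite setI0 cards0 muln0 addn0.
  have -> : edges2 (fun u v => r u v || false) (W :\: T) = edges2 r (W :\: T).
    by apply: eq_bigr => u _; apply: eq_bigr => v _; rewrite orbF.
  have := IH (W :\: T) ltac:(lia).
  have := edges2_le (W :\: T) rC rI rK.
  rewrite cW [3 + _]addnC f_add3; lia.
rewrite /triangles6 big1 // => x xW; rewrite big1 // => y yW; rewrite big1 // => z zW.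
apply/eqP; rewrite eqb0; apply: contra none => xyz.
apply/exists_inP; exists x => //; apply/exists_inP; exists y => //.
by apply/exists_inP; exists z.
Qed.

(* Either [S] meets at least [#|W :&: S|] red edges, or some vertex of [S] lies
   on at most one red edge, hence in no red triangle, and can be deleted. *)
Lemma triangles6_at_le S r W : symmetric r -> irreflexive r -> K4_free r ->
  triangles6 r W + 6 * #|W :&: S| <= 3 * edges2_at S r W + 6 * maxn (f #|W|) #|W|.
Proof.
move=> rC rI rK; have [k] := ubnP #|W|; elim: k W => // k IH W leW.
have [le|lt] := leqP (2 * #|W :&: S|) (edges2_at S r W).
  have := triangles6_le W rC rI rK; lia.
have [v vWS dv] : exists2 v, v \in W :&: S & \sum_(z in W) r v z <= 1.
  apply/exists_inP; apply: contraLR lt; rewrite negb_exists_in => /forall_inP all2.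
  rewrite -leqNgt mulnC -sum_nat_const.
  apply: (@leq_trans (\sum_(y in W :&: S) \sum_(z in W) r y z)).
    by apply: leq_sum => v /all2; rewrite -ltnNge.
  rewrite /edges2_at (sum_setD _ (subsetIl W S)).
  apply: leq_trans (leq_addr _ _); apply: leq_sum => y; rewrite inE => /andP[_ yS].
  by rewrite yS; apply: leq_sum => z _; rewrite andbT.
have /setIP[vW vS] := vWS.
have v1W : [set v] \subset W by rewrite sub1set.
have cW : #|W| = #|W :\: [set v]|.+1 by rewrite (cardsD1 v) vW.
have := IH (W :\: [set v]) ltac:(lia); rewrite (triangles6_setD rC v1W).
have -> : triangles6 r [set v] = 0 by rewrite /triangles6 !big_set1 rI.
rewrite big1 => [|z _]; last by rewrite !big_set1 rI.
rewrite big1 => [|y yD]; last first.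
  rewrite big1 // => z zD; rewrite big_set1.
  apply/eqP; rewrite eqb0; apply/negP=> /and3P[yz yv zv].
  have yz' : y != z by apply: contraTneq yz => ->; rewrite rI.
  have zW' : z \in W :\ y by move: zD; rewrite !inE [z == y]eq_sym yz' => /andP[].
  move: yD; rewrite inE => /andP[_ yW].
  by move: dv; rewrite (big_setD1 y) //= (big_setD1 z) //= !(rC v) yv zv.
have -> : #|W :&: S| = #|(W :\: [set v]) :&: S|.+1.
  by rewrite (cardsD1 v) vWS setIDAC.
have : edges2_at S r (W :\: [set v]) <= edges2_at S r W.
  rewrite /edges2_at [leqRHS](sum_setD _ v1W).
  apply: leq_trans (leq_addl _ _); apply: leq_sum => y _.
  by rewrite [leqRHS](sum_setD _ v1W) leq_addl.
(* The strict growth of the maximum covers the 6 lost with [v]. *)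
have := f_step #|W :\: [set v]|; rewrite cW; lia.
Qed.

Lemma red_blue_le r b W : symmetric r -> symmetric b -> irreflexive r -> irreflexive b ->
  (forall x y, ~~ (r x y && b x y)) -> K4_free (fun x y => r x y || b x y) ->
  9 <= #|W| -> triangles6 r W + 3 * edges2 b W <= 6 * f #|W|.
Proof.
move=> rC bC rI bI rb gK W9.
have gC : symmetric (fun x y => r x y || b x y) by move=> x y; rewrite rC bC.
have gI : irreflexive (fun x y => r x y || b x y) by move=> x; rewrite rI bI.
have rK : K4_free r.
  move=> x y z t; apply: contra (gK x y z t).
  by case/and5P=> -> -> -> -> /andP[-> ->].
have bK : K4_free b.
  move=> x y z t; apply: contra (gK x y z t).
  by case/and5P=> -> -> -> -> /andP[-> ->]; rewrite !orbT.
have [|none] := boolP [exists x in W, exists y in W, exists z in W,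
    [&& r x y, r y z & r x z]].
  move=> /exists_inP[x xW /exists_inP[y yW /exists_inP[z zW /and3P[xy yz xz]]]].
  pose T := [set x; y; z].
  have neq u v : r u v -> u != v by apply: contraTneq => ->; rewrite rI.
  have cT : #|T| = 3 by rewrite /T setUC cardsU1 cards2 !inE !(eq_sym z) negb_or !neq.
  have TW : T \subset W.
    by apply/subsetP=> u; rewrite !inE -orbA => /or3P[] /eqP->.
  have cW : #|W| = 3 + #|W :\: T| by rewrite -cT -[LHS](cardsID T) (setIidPr TW).
  have := @red_triangle_split r b W x y z rC bC rI bI rb gK TW xy xz yz; rewrite -/T.
  set S := [set z | _].
  have := triangles6_at_le S (W :\: T) rC rI rK.
  have := edges2_le (W :\: T) gC gI gK.
  (* The terms in [S] cancel between the two estimates, and having at least 6 vertices left turns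
     the maximum into [f]. *)
  have := @f_gt #|W :\: T| ltac:(lia).
  rewrite cW [3 + _]addnC f_add3; lia.
have -> : triangles6 r W = 0.
  rewrite /triangles6 big1 // => x xW; rewrite big1 // => y yW; rewrite big1 // => z zW.
  apply/eqP; rewrite eqb0; apply: contra none => xyz.
  apply/exists_inP; exists x => //; apply/exists_inP; exists y => //.
  by apply/exists_inP; exists z.
have := edges2_le W bC bI bK; have := f_ge_turan W9; lia.
Qed.

End Counting.

(** * Systems on at least nine vertices *)

Lemma cards3P (T : finType) (e : {set T}) : #|e| = 3 ->
  exists a b c, [/\ a != b, a != c, b != c & e = [set a; b; c]].
Proof.
move=> e3; have /card_gt0P[a ae] : 0 < #|e| by rewrite e3.
have /cards2P[b [c [bc ebc]]] : #|e :\ a| == 2.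
  by move: e3; rewrite (cardsD1 a) ae add1n => -[->].
exists a, b, c; have := setD11 a e; rewrite ebc !inE => /negbT.
by rewrite negb_or => /andP[ab ac]; split; rewrite // -setUA -ebc setD1K.
Qed.

(** The ordered tuples are regrouped by the set they span, and each triple is spanned by its six
    orderings. *)
Lemma triples_le_sum (T : finType) (X : {set {set T}}) :
  (forall e, e \in X -> #|e| = 3) ->
  6 * #|X| <= \sum_(x : T) \sum_(y : T) \sum_(z : T) ([set x; y; z] \in X).
Proof.
move=> X3; rewrite pair_big pair_big /= mulnC -sum_nat_const.
rewrite (eq_bigr (fun t => \sum_(e in X) ([set t.1.1; t.1.2; t.2] == e))); last first.
  move=> t _; have [tX|tX] := boolP (_ \in X).
    by rewrite (bigD1 _ tX) /= eqxx big1 // => e /andP[_ /negbTE]; rewrite eq_sym => ->.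
  by rewrite big1 // => e eX; apply/eqP; rewrite eqb0; apply: contraNneq tX => ->.
rewrite exchange_big; apply: leq_sum => e /X3/cards3P[a [b [c [ab ac bc ->]]]].
pose l := [:: (a, b, c); (a, c, b); (b, a, c); (b, c, a); (c, a, b); (c, b, a)].
rewrite -(big_mkcond (fun t : T * T * T => [set t.1.1; t.1.2; t.2] == [set a; b; c])
  (fun=> 1)) /= sum1_card.
apply/card_geqP; exists l; split=> // [|t].
  rewrite /= !inE !xpair_eqE !eqxx !(eq_sym c) !(eq_sym b a).
  by rewrite (negbTE ab) (negbTE ac) (negbTE bc).
rewrite !inE => tl; change ([set t.1.1; t.1.2; t.2] == [set a; b; c]).
apply/eqP/setP=> x; rewrite !inE.
by case/or4P: tl => [/eqP->|/eqP->|/eqP->|/or3P[/eqP->|/eqP->|/eqP->]] /=;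
  case: (x == a); case: (x == b); case: (x == c).
Qed.


Lemma pairs_le_sum (T : finType) (B : {set {set T}}) :
  (forall p, p \in B -> #|p| = 2) ->
  2 * #|B| <= \sum_(x : T) \sum_(y : T) ([set x; y] \in B).
Proof.
move=> B2; rewrite pair_big /= mulnC -sum_nat_const.
rewrite (eq_bigr (fun t => \sum_(e in B) ([set t.1; t.2] == e))); last first.
  move=> t _; have [tB|tB] := boolP (_ \in B).
    by rewrite (bigD1 _ tB) /= eqxx big1 // => e /andP[_ /negbTE]; rewrite eq_sym => ->.
  by rewrite big1 // => e eB; apply/eqP; rewrite eqb0; apply: contraNneq tB => ->.
rewrite exchange_big; apply: leq_sum => e /B2/eqP/cards2P[a [b [ab ->]]].
rewrite -(big_mkcond (fun t : T * T => [set t.1; t.2] == [set a; b]) (fun=> 1)) /= sum1_card.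
apply/card_geqP; exists [:: (a, b); (b, a)]; split=> // [|t].
  by rewrite /= !inE !xpair_eqE (negbTE ab).
rewrite !inE => tl; change ([set t.1; t.2] == [set a; b]).
apply/eqP/setP=> x; rewrite !inE.
by case/orP: tl => /eqP-> //=; rewrite orbC.
Qed.

(** A K4 whose edges have distinct representatives in [H] is the core of a Berge-K4. *)
Lemma K4_has_berge n (H : {set {set 'I_n}}) (g : rel 'I_n) (rep : {set 'I_n} -> {set 'I_n})
    (P : {set {set 'I_n}}) :
  (forall x y, g x y = ([set x; y] \in P)) -> irreflexive g ->
  {in P &, injective rep} ->
  {in P, forall p, rep p \in H /\ p \subset rep p} ->
  ~ has_berge_K4 H -> K4_free g.
Proof.
move=> gP gI repI repP noB x y z t; apply/negP=> gxyzt; apply: noB.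
have gC : symmetric g by move=> u v; rewrite !gP setUC.
pose v (i : 'I_4) := nth x [:: x; y; z; t] i.
have gv (i j : 'I_4) : i < j -> g (v i) (v j).
  case/and5P: gxyzt => ? ? ? ? /andP[? ?].
  by case: i j => [[|[|[|[|i]]]] ?] [[|[|[|[|j]]]] ?].
have vI : injective v.
  move=> i j eij; apply: val_inj; case: (ltngtP i j) => //.
    by move=> /gv; rewrite eij gI.
  by move=> /gv; rewrite eij gI.
exists v, (fun i j => rep [set v i; v j]); split=> //; split=> [i j ij|i j k l ij kl].
  have [repH] := repP [set v i; v j] ltac:(by rewrite -gP gv).
  by rewrite subUset !sub1set => /andP[].
move/repI; rewrite -!gP !gv // => /(_ isT isT) /setP eqs.
have := eqs (v i); have := eqs (v j); rewrite !inE !eqxx ?orbT !(inj_eq vI).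
move=> /esym/orP[]/eqP ej /esym/orP[]/eqP ei; subst => //; move: ij kl; lia.
Qed.

Lemma berge_free_le n (H : {set {set 'I_n}}) : 9 <= n ->
  triple_system H -> berge_free H -> #|H| <= f n.
Proof.
move=> n9 H3 Hfree.
pose N (e : {set 'I_n}) := [set p : {set 'I_n} | (p \subset e) && (#|p| == 2)].
have [X [XH [phi [phiI phiN]] [psi [psiI psiN]]]] := Hall_split set0 set0 N H.
pose R := nbhd N X; pose B := phi @: (H :\: X).
have R2 p : p \in R -> #|p| = 2 by case/bigcupP=> e _; rewrite inE => /andP[_ /eqP].
have BP p : p \in B -> exists2 e, e \in H :\: X & [/\ phi e = p, p \subset e, #|p| = 2 & p \notin R].
  case/imsetP=> e eHX ->; exists e => //; have := phiN e eHX.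
  by rewrite !inE => /and3P[? ? /eqP].
pose r : rel 'I_n := fun x y => [set x; y] \in R.
pose b : rel 'I_n := fun x y => [set x; y] \in B.
have rC : symmetric r by move=> x y; rewrite /r setUC.
have bC : symmetric b by move=> x y; rewrite /b setUC.
have rI : irreflexive r.
  by move=> x; apply/negP=> /R2; rewrite setUid cards1.
have bI : irreflexive b.
  by move=> x; apply/negP=> /BP[e _ [_ _]]; rewrite setUid cards1.
have rb x y : ~~ (r x y && b x y).
  by apply/negP=> /andP[xyR /BP[e _ [_ _ _]]]; rewrite -/(r x y) xyR.
(* A blue pair is represented by its preimage under [phi]; the default [set0] is never returned on
   [R :|: B]. *)
pose rep p := if p \in R then psi p else odflt set0 [pick e in H :\: X | phi e == p].
have repB p : p \in B -> [/\ rep p \in H :\: X, phi (rep p) = p & p \subset rep p].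
  move=> pB; have [e eHX [phie pe _ pR]] := BP p pB; rewrite /rep (negbTE pR).
  case: pickP => [e' /andP[e'HX /eqP phie'] | /(_ e)]; last by rewrite /= eHX phie eqxx.
  by split=> //=; rewrite (phiI e' e) // phie.
have repR p : p \in R -> [/\ rep p \in X, rep p = psi p & p \subset rep p].
  move=> pR; rewrite /rep pR; have [psiX] := psiN p pR.
  by rewrite inE => /andP[].
(* Red pairs have representatives in [X] and blue pairs outside [X], so the two colours never share
   one. *)
have gK : K4_free (fun x y => r x y || b x y).
  apply: (@K4_has_berge n H _ rep (R :|: B)) => //.
  - by move=> x y; rewrite inE.
  - by move=> x; rewrite rI bI.
  - move=> p q; rewrite !inE.
    case/orP=> [pR|pB]; case/orP=> [qR|qB].
    + by have [_ -> _] := repR p pR; have [_ -> _] := repR q qR; apply: psiI.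
    + have [pX _ _] := repR p pR; have [qX _ _] := repB q qB.
      by move=> e; move: qX; rewrite -e inE pX.
    + have [pX _ _] := repB p pB; have [qX _ _] := repR q qR.
      by move=> e; move: pX; rewrite e inE qX.
    + have [_ phip _] := repB p pB; have [_ phiq _] := repB q qB.
      by move=> e; rewrite -phip -phiq e.
  - move=> p; rewrite inE => /orP[/repR[pX _ ->]|/repB[]]; last by rewrite inE => /andP[_ ->].
    by rewrite (subsetP XH).
have := red_blue_le (W := setT) rC bC rI bI rb gK; rewrite cardsT card_ord => /(_ n9).
(* All pairs inside a triple of [X] are red, so the triple spans a red triangle. *)
have : 6 * #|X| <= triangles6 r setT.
  apply: leq_trans (triples_le_sum _) _; first by move=> e /(subsetP XH)/H3.
  rewrite /triangles6; under [leqRHS]eq_bigl do rewrite inE.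
  apply: leq_sum => x _; under [leqRHS]eq_bigl do rewrite inE.
  apply: leq_sum => y _; under [leqRHS]eq_bigl do rewrite inE.
  apply: leq_sum => z _; have [xyzX|] // := boolP (_ \in X).
  have e3 := H3 _ (subsetP XH _ xyzX).
  have in_R u v : u \in [set x; y; z] -> v \in [set x; y; z] -> u != v -> [set u; v] \in R.
    move=> ue ve uv; apply/bigcupP; exists [set x; y; z] => //.
    by rewrite inE cards2 uv subUset !sub1set ue ve.
  have xy : x != y.
    by apply: contra_eq_neq e3 => ->; rewrite setUid cards2; case: (y != z).
  have xz : x != z.
    by apply: contra_eq_neq e3 => ->; rewrite setUAC setUid cards2; case: (z != y).
  have yz : y != z.
    by apply: contra_eq_neq e3 => ->; rewrite -setUA setUid cards2; case: (x != z).
  by rewrite /r !in_R // !inE eqxx ?orbT.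
have : 2 * #|B| <= edges2 b setT.
  apply: leq_trans (pairs_le_sum _) _; first by move=> p /BP[e _ []].
  rewrite /edges2; under [leqRHS]eq_bigl do rewrite inE.
  apply: leq_sum => x _; under [leqRHS]eq_bigl do rewrite inE.
  by apply: leq_sum => y _.
have -> : #|B| = #|H| - #|X| by rewrite card_in_imset // cardsD (setIidPr XH).
have := subset_leq_card XH; lia.
Qed.

(** * Systems on six, seven and eight vertices *)

Definition triple := (nat * nat * nat)%type.

(* Colexicographic order: [triples k] is a prefix of [triples n] for [k <= n]. *)
Definition triples n : seq triple :=
  flatten [seq flatten [seq [seq (a, b, c) | a <- iota 0 b] | b <- iota 0 c]
    | c <- iota 0 n].

Definition quads n : seq (seq nat) :=
  flatten [seq [seq [:: t.1.1; t.1.2; t.2; d] | t <- triples d] | d <- iota 0 n].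

Definition incident (t : triple) x := [|| x == t.1.1, x == t.1.2 | x == t.2].

(* Bit vector of the triples that meet the 4-set [q] exactly in the positions
   satisfying [P]; triples with different traces are different. *)
Definition traces (ts : seq triple) (q : seq nat) (P : pred nat) : seq bool :=
  [seq all (fun l => incident t (nth 0 q l) == P l) (iota 0 4) | t <- ts].

(* Nested [if]s instead of [&&] keep the test lazy under call by value. *)
Fixpoint meets (h m : seq bool) : bool :=
  match h, m with
  | b :: h', c :: m' => if c then (if b then true else meets h' m') else meets h' m'
  | _, _ => false
  end.

(* Each pair of positions comes with the complementary pair: a triple inside a
   4-set covers the pair iff it omits an element of that complement. *)
Definition pairs4 : seq (nat * nat * (nat * nat)) :=
  [:: (0, 1, (2, 3)); (0, 2, (1, 3)); (0, 3, (1, 2));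
      (1, 2, (0, 3)); (1, 3, (0, 2)); (2, 3, (0, 1))].

(** Entry [k] of [faces] marks the triple inside the 4-set that omits position [k]; [outers] marks,
    for each pair, the triples meeting the 4-set in that pair only, and keeps the complementary
    pair. *)
Record quad_masks := QuadMasks {
  faces : seq (seq bool);
  outers : seq (seq bool * (nat * nat)) }.

Definition masks (ts : seq triple) (q : seq nat) : quad_masks :=
  QuadMasks [seq traces ts q (predC1 k) | k <- iota 0 4]
            [seq (traces ts q (pred2 p.1.1 p.1.2), p.2) | p <- pairs4].

(* Assigns distinct triples to the pairs of a 4-set. A triple with trace exactly
   the pair serves no other pair and is taken greedily; otherwise one of the
   two available triples inside the 4-set (marked in [av]) is tried. *)
Fixpoint sdr (h av : seq bool) (ps : seq (seq bool * (nat * nat))) : bool :=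
  match ps with
  | [::] => true
  | p :: ps' =>
    if meets h p.1 then sdr h av ps'
    else if (if nth false av p.2.1 then sdr h (set_nth false av p.2.1 false) ps'
             else false) then true
    else if nth false av p.2.2 then sdr h (set_nth false av p.2.2 false) ps'
    else false
  end.

Definition berge_test (h : seq bool) (q : quad_masks) : bool :=
  sdr h [seq meets h m | m <- faces q] (outers q).

(** One row per decision, with masks aligned to the latest-first history. A Berge-K4 completed by
    choosing [t] uses [t], so only 4-sets on the vertices up to [t.2] that share two points with [t]
    are tested. *)
Fixpoint table (rs ts : seq triple) : seq (seq quad_masks) :=
  match ts with
  | [::] => [::]
  | t :: ts' =>
    [seq masks (t :: rs) q | q <- quads t.2.+1 & 2 <= count (incident t) q]
      :: table (t :: rs) ts'
  end.

(* Decides the triples one at a time; [h] records the decisions, latest first,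
   and [c] counts the chosen triples. A branch is closed when [c] falls below
   the lower bound for the current prefix or a Berge-K4 appears. *)
Fixpoint search (tb : seq (seq quad_masks)) (need : seq nat) (h : seq bool) (c : nat) : bool :=
  if c < head 0 need then true else
  match tb with
  | [::] => false
  | qs :: tb' =>
    if (if has (berge_test (true :: h)) qs then true
        else search tb' (behead need) (true :: h) c.+1)
    then search tb' (behead need) (false :: h) c
    else false
  end.

(* A checkpoint [(k, l)] says that at least [l] of the first [k] triples are chosen. *)
Definition needed (cks : seq (nat * nat)) i : nat :=
  foldr (fun p m => if i <= p.1 then maxn (p.2 - (p.1 - i)) m else m) 0 cks.

Definition refuted n (cks : seq (nat * nat)) : bool :=
  search (table [::] (triples n))
    [seq needed cks i | i <- iota 0 (size (triples n)).+1] [::] 0.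

Lemma mem_triples n a b c : ((a, b, c) \in triples n) = (a < b < c) && (c < n).
Proof.
apply/flatten_mapP/idP => [[c']|/andP[/andP[ab bc] cn]].
  rewrite mem_iota => /= c'n /flatten_mapP[b']; rewrite mem_iota => /= b'c'.
  by move/mapP=> [a']; rewrite mem_iota => /= a'b' [-> -> ->]; lia.
exists c; first by rewrite mem_iota.
apply/flatten_mapP; exists b; first by rewrite mem_iota.
by apply: map_f; rewrite mem_iota.
Qed.

Lemma mem_quads n q : q \in quads n ->
  [/\ size q = 4, uniq q & all (fun x => x < n) q].
Proof.
case/flatten_mapP=> d; rewrite mem_iota => /= dn /mapP[[[a b] c]].
rewrite mem_triples => abc ->; split=> //=; first by rewrite !inE; lia.
by lia.
Qed.

Lemma meets_map (w P : pred triple) ts :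
  meets (map w ts) (map P ts) = has (predI w P) ts.
Proof. by elim: ts => //= t ts ->; case: (w t); case: (P t). Qed.

(** The witness [cs] records the choice for each pair: [None] is a triple whose trace is the pair,
    [Some k] the triple inside the 4-set omitting position [k]. Clearing entry [k] of [av] ensures
    single use. *)
Lemma sdrP h av ps : sdr h av ps ->
  exists cs : nat -> option nat,
    (forall i, i < size ps -> let p := nth ([::], (0, 0)) ps i in
      if cs i is Some k then ((k == p.2.1) || (k == p.2.2)) && nth false av k
      else meets h p.1) /\
    (forall i j k, i < size ps -> j < size ps -> cs i = Some k -> cs j = Some k -> i = j).
Proof.
elim: ps av => [|p ps IH] av /=; first by exists (fun=> None); split.
have use k : (k == p.2.1) || (k == p.2.2) -> nth false av k ->
    sdr h (set_nth false av k false) ps ->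
  exists cs : nat -> option nat,
    (forall i, i < (size ps).+1 -> let p := nth ([::], (0, 0)) (p :: ps) i in
      if cs i is Some k then ((k == p.2.1) || (k == p.2.2)) && nth false av k
      else meets h p.1) /\
    (forall i j k, i < (size ps).+1 -> j < (size ps).+1 ->
      cs i = Some k -> cs j = Some k -> i = j).
  move=> kp avk /IH[cs [csP csI]].
  have csk i : i < size ps -> cs i <> Some k.
    by move=> ilt e; have := csP i ilt; rewrite /= e nth_set_nth /= eqxx andbF.
  exists (fun i => if i is i'.+1 then cs i' else Some k); split.
    case=> [|i] /= lti; first by rewrite kp.
    have /= := csP i lti; case: (cs i) => // k'.
    by rewrite nth_set_nth /=; case: (k' == k); rewrite ?andbF.
  case=> [|i] [|j] k' //= ilt jlt; first by move=> [<-] /csk; case.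
    by move=> e [ek]; move: e; rewrite -ek => /csk; case.
  by move=> ei ej; rewrite (csI i j k').
case: ifP => [m /IH[cs [csP csI]]|_].
  exists (fun i => if i is i'.+1 then cs i' else None); split.
    by case=> [|i] //=; apply: csP.
  by case=> [|i] [|j] k' //= ilt jlt ei ej; rewrite (csI i j k').
case e1 : (nth false av p.2.1); last first.
  by case e2 : (nth false av p.2.2) => //; apply: use; rewrite ?eqxx ?orbT.
case: ifP => [s1 _|_]; first by apply: (use p.2.1); rewrite ?eqxx.
by case e2 : (nth false av p.2.2) => //; apply: use; rewrite ?eqxx ?orbT.
Qed.

(** * Soundness of the search *)

Section Soundness.
Variables (n : nat) (H : {set {set 'I_n}}) (s : nat -> 'I_n).
Hypothesis s_inj : {in gtn n &, injective s}.

Definition realize (t : triple) : {set 'I_n} := [set s t.1.1; s t.1.2; s t.2].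
Definition chosen (t : triple) : bool := realize t \in H.

Lemma mem_realize t x : t \in triples n -> x < n -> (s x \in realize t) = incident t x.
Proof.
case: t => [[a b] c]; rewrite mem_triples => abc xn.
have E y : y < n -> (s x == s y) = (x == y).
  by move=> yn; apply/eqP/eqP => [/s_inj->|->].
by rewrite !inE /incident /= !E -?orbA //; lia.
Qed.

(** The assignment from [sdrP] prescribes the trace of each hyperedge on the 4-set; traces give the
    incidences and also separate the hyperedges. *)
Lemma berge_test_sound ts q : {subset ts <= triples n} ->
  [/\ size q = 4, uniq q & all (fun x => x < n) q] ->
  berge_test (map chosen ts) (masks ts q) -> has_berge_K4 H.
Proof.
move=> tsn [q4 qU qn] /sdrP[cs [csP csI]].
have qln l : l < 4 -> nth 0 q l < n.
  by move=> l4; apply: (allP qn); rewrite mem_nth ?q4.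
pose v (l : 'I_4) := s (nth 0 q l).
have tr P : meets (map chosen ts) (traces ts q P) ->
    exists2 e, e \in H & forall l : 'I_4, (v l \in e) = P l.
  rewrite meets_map => /hasP[t tts /andP[tH Pt]].
  have {}Pt : all (fun l => incident t (nth 0 q l) == P l) (iota 0 4) := Pt.
  exists (realize t) => // l; rewrite mem_realize ?tsn ?qln //.
  by apply/eqP/(allP Pt); rewrite mem_iota ltn_ord.
pose pos (i j : 'I_4) := index (val i, val j) [seq p.1 | p <- pairs4].
have posP (i j : 'I_4) : i < j -> exists k1 k2 : 'I_4,
    [/\ pos i j < 6, nth (0, 0, (0, 0)) pairs4 (pos i j) = (val i, val j, (val k1, val k2)),
        k1 != k2 & [&& i != k1, i != k2, j != k1 & j != k2]].
  case: i j => [[|[|[|[|i]]]] ?] [[|[|[|[|j]]]] ?] // _.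
  - by exists (inord 2), (inord 3); rewrite -!(inj_eq val_inj) /= !inordK.
  - by exists (inord 1), (inord 3); rewrite -!(inj_eq val_inj) /= !inordK.
  - by exists (inord 1), (inord 2); rewrite -!(inj_eq val_inj) /= !inordK.
  - by exists (inord 0), (inord 3); rewrite -!(inj_eq val_inj) /= !inordK.
  - by exists (inord 0), (inord 2); rewrite -!(inj_eq val_inj) /= !inordK.
  - by exists (inord 0), (inord 1); rewrite -!(inj_eq val_inj) /= !inordK.
(* The prescribed trace: three positions for a triple inside the 4-set, otherwise the pair
   itself. *)
pose T i j (l : 'I_4) : bool :=
  if cs (pos i j) is Some k then val l != k else (l == i) || (l == j).
have TP (i j : 'I_4) : i < j -> (exists2 e, e \in H & forall l, (v l \in e) = T i j l) /\
    (forall k, cs (pos i j) = Some k -> exists2 l : 'I_4, val l = k & (i != l) && (j != l)).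
  move=> ij; have [k1 [k2 [p6 eqp k12 /and4P[ik1 ik2 jk1 jk2]]]] := posP i j ij.
  have := csP (pos i j); rewrite size_map => /(_ p6); cbv zeta.
  have -> : nth ([::], (0, 0)) (outers (masks ts q)) (pos i j) =
      (traces ts q (pred2 (val i) (val j)), (val k1, val k2)).
    by rewrite [LHS](nth_map (0, 0, (0, 0))) // eqp.
  rewrite /T; cbn [fst snd].
  case: (cs (pos i j)) => [k|/tr //] /andP[k1k2 av].
  have [l lk il] : exists2 l : 'I_4, val l = k & (i != l) && (j != l).
    by case/orP: k1k2 => /eqP->; [exists k1|exists k2]; rewrite // ?ik1 ?ik2.
  split; last by move=> _ [<-]; exists l.
  move: av; rewrite -lk.
  have -> : nth false [seq meets (map chosen ts) m | m <- faces (masks ts q)] l =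
    meets (map chosen ts) (traces ts q (predC1 (val l))) by case: (l) => [[|[|[|[|]]]] ?].
  exact: tr.
pose e i j := odflt set0 [pick e in H | [forall l, (v l \in e) == T i j l]].
have eP (i j : 'I_4) : i < j -> e i j \in H /\ forall l, (v l \in e i j) = T i j l.
  move=> /TP[[e0 e0H e0T] _]; rewrite /e.
  case: pickP => [e1 /andP[e1H /forallP e1T]|/(_ e0)]; first by split=> // l; apply/eqP.
  by rewrite /= e0H => /negbT/forallPn[l]; rewrite e0T eqxx.
have TT (i j : 'I_4) : i < j -> T i j i && T i j j.
  move=> /TP[_]; rewrite /T; case: (cs _) => [k /(_ k erefl)[l <-]|_]; last by rewrite !eqxx orbT.
  by rewrite !(inj_eq val_inj).
exists v, e; split; [|split].
- move=> i j /s_inj; rewrite !inE !qln // => /(_ isT isT) /eqP.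
  by rewrite nth_uniq ?q4 // => /eqP/val_inj.
- by move=> i j ij; have [eH eT] := eP i j ij; have /andP[] := TT i j ij; rewrite -!eT; split.
(* Equal hyperedges have equal traces. Three-point traces agree only for the same pair, by [csI]; a
   three-point trace is never a two-point one; a two-point trace is its pair. *)
move=> i j k l ij kl eq_e.
have eqT m : T i j m = T k l m.
  by have [_ <-] := eP i j ij; have [_ <-] := eP k l kl; rewrite eq_e.
have [i1 [i2 [p6 eqp i12 /and4P[ii1 ii2 ji1 ji2]]]] := posP i j ij.
have [k1 [k2 [p6' eqp' k12 /and4P[kk1 kk2 lk1 lk2]]]] := posP k l kl.
have := eqT i1; have := eqT i2; have := eqT k1; have := eqT k2.
have := eqT i; have := eqT j; have := eqT k; have := eqT l.
have [_ cij] := TP i j ij; have [_ ckl] := TP k l kl.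
rewrite /T; case eij: (cs (pos i j)) cij => [a|] cij; case ekl: (cs (pos k l)) ckl => [b|] ckl.
- have [m ma _] := cij a erefl; have := eqT m; rewrite /T eij ekl ma eqxx => /esym/negbFE/eqP ab.
  have ep : pos i j = pos k l by apply: (csI _ _ a); rewrite ?size_map // ab.
  move: eqp'; rewrite -ep eqp => -[/val_inj-> /val_inj-> _ _] //.
- have [m ma _] := cij a erefl; rewrite -ma !(inj_eq val_inj).
  rewrite ![k1 == _]eq_sym ![k2 == _]eq_sym (negbTE kk1) (negbTE kk2) (negbTE lk1) (negbTE lk2).
  by move=> _ _ _ _ /negbFE/eqP e2 /negbFE/eqP e1; rewrite -e1 -e2 eqxx in k12.
- have [m ma _] := ckl b erefl; rewrite -ma !(inj_eq val_inj).
  rewrite ![i1 == _]eq_sym ![i2 == _]eq_sym (negbTE ii1) (negbTE ii2) (negbTE ji1) (negbTE ji2).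
  by move=> _ _ _ _ _ _ /esym/negbFE/eqP e2 /esym/negbFE/eqP e1; rewrite -e1 -e2 eqxx in i12.
move=> Tl Tk _ _ _ _ _ _.
have : (k == i) || (k == j) by rewrite Tk eqxx.
have : (l == i) || (l == j) by rewrite Tl eqxx orbT.
case/orP=> /eqP el; case/orP=> /eqP ek; rewrite el ek ?ltnn // in kl *.
by have := ltn_trans ij kl; rewrite ltnn.
Qed.

(** The decisions describing [H] form one branch. Its counts respect the lower bounds and a
    completed branch returns [false], so only a Berge-K4 can have closed it. *)
Lemma search_sound rs ts need c : {subset rs <= triples n} -> {subset ts <= triples n} ->
  search (table rs ts) need (map chosen rs) c ->
  (forall i, i <= size ts -> nth 0 need i <= c + count chosen (take i ts)) ->
  has_berge_K4 H.
Proof.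
elim: ts rs need c => [|t ts IH] rs need c rsn tsn /=.
  by case: ifP => // + _ /(_ 0 isT); rewrite nth0 addn0; lia.
case: ifP => [+ _ /(_ 0 isT)|_]; first by rewrite nth0 addn0; lia.
have tn : t \in triples n by apply: tsn; rewrite mem_head.
have trsn : {subset t :: rs <= triples n}.
  by move=> u; rewrite inE => /predU1P[->|/rsn].
have tsn' : {subset ts <= triples n} by move=> u uts; apply: tsn; rewrite inE uts orbT.
have IHt b c' (sb : chosen t = b) :
    search (table (t :: rs) ts) (behead need) (b :: map chosen rs) c' -> c' = c + b ->
    (forall i, i <= (size ts).+1 -> nth 0 need i <= c + count chosen (take i (t :: ts))) ->
    has_berge_K4 H.
  move=> sr ec cnt; apply: (IH (t :: rs) (behead need) c') => //=; first by rewrite sb.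
  by move=> i ile; have := cnt i.+1 ile; rewrite nth_behead /= sb ec addnA.
have [tH|/negbTE tH] := boolP (chosen t); last first.
  by case: ifP => // _ sr; apply: IHt tH sr _; rewrite addn0.
case: ifP => // + _; case: ifP => [hasq _ _|_ sr]; last by apply: IHt tH sr _; rewrite addn1.
move: hasq; rewrite has_map => /hasP[q].
rewrite mem_filter => /andP[_ /mem_quads[q4 qU qn]] /=.
have -> : true :: map chosen rs = map chosen (t :: rs) by rewrite /= tH.
apply: berge_test_sound => //; split=> //; apply: sub_all qn => x /leq_trans; apply.
by case: (t) tn => [[? ?] ?]; rewrite mem_triples => /andP[].
Qed.

Lemma refuted_sound cks : refuted n cks ->
  (forall p, p \in cks -> p.2 <= count chosen (take p.1 (triples n))) -> has_berge_K4 H.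
Proof.
move=> sr cksP; apply: (search_sound _ _ sr) => // i ile.
rewrite (nth_map 0) ?size_iota // nth_iota // add0n add0n.
elim: cks cksP {sr} => //= p cks IH cksP.
have := IH (fun p' p'c => cksP p' ltac:(by rewrite inE p'c orbT)).
(* Between positions [i] and [p.1] at most [p.1 - i] triples are chosen, hence the subtraction in
   [needed]. *)
case: ifP => // ip; rewrite geq_max => ->; rewrite andbT leq_subLR.
apply: leq_trans (cksP p (mem_head _ _)) _.
have {1}-> : p.1 = i + (p.1 - i) by lia.
rewrite takeD count_cat addnC leq_add2r.
by apply: leq_trans (count_size _ _) _; rewrite size_take; case: ifP => //; lia.
Qed.

End Soundness.

(** * Vertex orderings by minimum degree *)

Section Ordering.
Variables (V : finType) (H : {set {set V}}).
Hypothesis H3 : forall e, e \in H -> #|e| = 3.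

Definition inside (s : seq V) := #|[set e in H | e \subset s]|.

Lemma eq_inside s1 s2 : s1 =i s2 -> inside s1 = inside s2.
Proof. by move=> eqs; apply: eq_card => e; rewrite !inE (eq_subset_r eqs). Qed.

(* Holds for a vertex of minimum degree. *)
Lemma exists_low_degree (S : {set V}) : S != set0 ->
  exists2 x, x \in S & (#|S| - 3) * inside (enum S) <= #|S| * inside (enum (S :\ x)).
Proof.
move=> S0; apply/exists_inP; apply: contraT; rewrite negb_exists_in => /forall_inP low.
pose E := [set e in H | e \subset S].
have insE : inside (enum S) = #|E|.
  by apply: eq_card => e; rewrite !inE; congr (_ && _); apply: eq_subset_r => x; rewrite mem_enum.
have insEx x : x \in S -> inside (enum (S :\ x)) + #|[set e in E | x \in e]| = #|E|.
  move=> xS; rewrite -[RHS](cardsID [set e : {set V} | x \notin e]); congr (_ + _).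
    apply: eq_card => e; rewrite !inE -andbA; congr (_ && _).
    by rewrite (eq_subset_r (mem_enum _)) subsetD1.
  by apply: eq_card => e; rewrite !inE negbK andbC.
have degs : \sum_(x in S) #|[set e in E | x \in e]| = #|E| * 3.
  rewrite -sum_nat_const (eq_bigr (fun x => \sum_(e in E) (x \in e))) => [|x _].
    rewrite exchange_big; apply: eq_bigr => e; rewrite inE => /andP[/H3 e3 /subsetP eS].
    rewrite -e3 -sum1_card [RHS]big_mkcond [LHS]big_mkcond /=; apply: eq_bigr => x _.
    by have [/eS->|] := boolP (x \in e); rewrite ?if_same.
  by rewrite -sum1_card [RHS]big_mkcond [LHS]big_mkcond; apply: eq_bigr => e _; rewrite !inE;
    case: (e \in H); case: (e \subset S); case: (x \in e).
(* If every vertex failed, summing the strict inequalities, encoded by [+ 1], would contradict the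
   degree sum [#|E| * 3]. *)
have : \sum_(x in S) (#|S| * inside (enum (S :\ x)) + 1) <= \sum_(x in S) (#|S| - 3) * #|E|.
  by apply: leq_sum => x /low; rewrite -ltnNge insE addn1.
have : \sum_(x in S) (inside (enum (S :\ x)) + #|[set e in E | x \in e]|) = #|S| * #|E|.
  by rewrite -sum_nat_const; apply: eq_bigr => x; apply: insEx.
rewrite !big_split /= degs -big_distrr /= sum1_card sum_nat_const.
move: S0; rewrite -card_gt0; set A := \sum_(x in S) _.
move: #|S| #|E| A => k c A k0 eA; rewrite -mulnSr leq_pmul2l //.
by rewrite mulnBl -eA; lia.
Qed.

Lemma exists_ordering (S : {set V}) : exists s : seq V, [/\ uniq s, s =i S &
  forall k, k < size s -> (k.+1 - 3) * inside (take k.+1 s) <= k.+1 * inside (take k s)].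
Proof.
have [m] := ubnP #|S|; elim: m S => // m IH S leS.
have [->|S0] := eqVneq S set0; first by exists [::]; split=> // x; rewrite inE.
have [x xS low] := exists_low_degree S0.
have [s [us sS sP]] := IH (S :\ x) ltac:(by rewrite (cardsD1 x) xS in leS).
have xs : x \notin s by rewrite sS !inE eqxx.
have rS : rcons s x =i S.
  by move=> y; rewrite mem_rcons inE sS !inE; case: eqP => [->|].
have cS : #|S| = (size s).+1.
  by rewrite -(eq_card rS) (card_uniqP _) ?size_rcons // rcons_uniq xs.
exists (rcons s x); split=> // [|k]; first by rewrite rcons_uniq xs.
rewrite size_rcons ltnS leq_eqVlt => /predU1P[->|ks].
  rewrite take_oversize ?size_rcons // -[in take _ _]cats1 take_size_cat // -cS.
  rewrite (@eq_inside (rcons s x) (enum S)) => [|y]; last by rewrite mem_enum rS.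
  by rewrite (@eq_inside s (enum (S :\ x))) // => y; rewrite mem_enum sS.
by rewrite -cats1 !takel_cat ?sP //; lia.
Qed.
End Ordering.

Lemma inside_le_count n (H : {set {set 'I_n}}) (H3 : triple_system H) (x0 : 'I_n)
    (s : seq 'I_n) k :
  uniq s -> k <= size s ->
  inside H (take k s) <= count (chosen H (nth x0 s)) (triples k).
Proof.
move=> us ks; rewrite -size_filter -(size_map (realize (nth x0 s))).
apply: leq_trans (card_size _); apply: subset_leq_card; apply/subsetP=> e.
rewrite inE => /andP[eH /subsetP es].
have [a [b [c [ab ac bc ee]]]] := cards3P (H3 e eH).
have idx x : x \in e -> exists2 i, i < k & x = nth x0 s i.
  move=> /es xs; exists (index x s); first by rewrite -in_take // (mem_take xs).
  by rewrite nth_index // (mem_take xs).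
suff [t tk et] : exists2 t, t \in triples k & e = realize (nth x0 s) t.
  by rewrite et; apply: map_f; rewrite mem_filter tk andbT /chosen -et.
have [i ik ai] := idx a ltac:(by rewrite ee !inE eqxx).
have [j jk bj] := idx b ltac:(by rewrite ee !inE eqxx orbT).
have [l lk cl] := idx c ltac:(by rewrite ee !inE eqxx !orbT).
have {}ab : i != j by apply: contraNneq ab => ij; rewrite ai bj ij.
have {}ac : i != l by apply: contraNneq ac => il; rewrite ai cl il.
have {}bc : j != l by apply: contraNneq bc => jl; rewrite bj cl jl.
rewrite ee ai bj cl /realize {ee es idx ai bj cl eH e a b c}.
wlog ij : i j ik jk ab ac bc / i < j.
  move=> th; have [|ji|e] := ltngtP i j; [exact: th| |by rewrite e eqxx in ab].
  have [t tk et] := th j i jk ik ltac:(by rewrite eq_sym) bc ac ji.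
  by exists t; rewrite // -et [X in X :|: _]setUC.
have [il|li] := leqP l i; last have [jl|lj] := leqP l j.
- exists (l, i, j); first by rewrite mem_triples; lia.
  by rewrite /= [RHS]setUC setUA [RHS]setUC setUC; apply/setP=> y; rewrite !inE;
    case: (y == _); case: (y == _); case: (y == _).
- exists (i, l, j); first by rewrite mem_triples; lia.
  by apply/setP=> y; rewrite !inE /= orbAC.
by exists (i, j, l); first by rewrite mem_triples; lia.
Qed.

Lemma take_triples n k : k <= n -> take (size (triples k)) (triples n) = triples k.
Proof.
by move=> kn; rewrite /triples -(subnKC kn) iotaD map_cat flatten_cat take_size_cat.
Qed.

(** In a low-degree ordering of a system with more than [m] triples, [b k] bounds from below the
    triples among the first [k] vertices; the last hypothesis on [b] is one step of that
    averaging. *)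
Lemma refuted_le n (H : {set {set 'I_n}}) (b : nat -> nat) m :
  0 < n -> triple_system H -> berge_free H ->
  refuted n [seq (size (triples k), b k) | k <- iota 0 n.+1] ->
  b n = m.+1 ->
  (forall k c, k < n -> b k.+1 <= c -> forall c', (k.+1 - 3) * c <= k.+1 * c' -> b k <= c') ->
  #|H| <= m.
Proof.
move=> n0 H3 Hfree ref bn bstep; rewrite leqNgt; apply/negP=> lt; apply: Hfree.
have [s [us sT sP]] := exists_ordering H3 setT.
have ss : size s = n by rewrite -(card_uniqP us) (eq_card sT) cardsT card_ord.
pose x0 : 'I_n := Ordinal n0.
(* The induction descends from all [n] vertices, with [k] counting the removed ones. *)
have ins k : k <= n -> b (n - k) <= inside H (take (n - k) s).
  elim: k => [|k IH] kn.
    rewrite subn0 bn take_oversize ?ss //; apply: leq_trans lt _; apply: subset_leq_card.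
    by apply/subsetP=> e eH; rewrite inE eH; apply/subsetP=> x _; rewrite sT inE.
  have lt' : n - k.+1 < n by lia.
  have En : n - k = (n - k.+1).+1 by lia.
  apply: (bstep _ (inside H (take (n - k) s)) lt'); first by rewrite -En IH //; lia.
  by rewrite En; apply: sP; rewrite ss.
apply: (@refuted_sound n H (nth x0 s)) ref _.
  by move=> i j; rewrite !inE => il jl /eqP; rewrite nth_uniq ?ss // => /eqP.
move=> p /mapP[k]; rewrite mem_iota add0n ltnS => /= kn ->.
rewrite take_triples //; apply: leq_trans (inside_le_count H3 x0 us _); last by rewrite ss.
by have := ins (n - k) (leq_subr _ _); rewrite subKn.
Qed.

(** * The balanced 3-partite system *)

Lemma card_ord_interval n lo hi : hi <= n ->
  #|[set i : 'I_n | lo <= i < hi]| = hi - lo.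
Proof.
move=> hin; rewrite -[RHS]muln1 -sum_nat_const_nat (big_nat_widen _ _ n) //.
by rewrite big_geq_mkord -sum1_card; apply: eq_bigl => i; rewrite inE andbC.
Qed.

Lemma balanced_3partiteP n (e : {set 'I_n}) : e \in balanced_3partite n ->
  exists a b c, [/\ a \in partA n, b \in partB n, c \in partC n & e = [set a; b; c]].
Proof.
rewrite inE => /exists_inP[a aA /exists_inP[b bB /exists_inP[c cC /eqP ->]]].
by exists a, b, c.
Qed.

Lemma balanced_triple_system n : triple_system (balanced_3partite n).
Proof.
move=> e /balanced_3partiteP[a [b [c [aA bB cC ->]]]].
move: aA bB cC; rewrite !inE => aA /andP[b1 b2] cC.
by rewrite setUC cardsU1 cards2 !inE -!(inj_eq val_inj) /=; lia.
Qed.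

(** Two of the four core vertices share a part, yet no triple contains two vertices of one part. *)
Lemma balanced_berge_free n : berge_free (balanced_3partite n).
Proof.
case=> v [e [vI [eP _]]].
pose part (i : 'I_n) : 'I_3 :=
  if i \in partA n then inord 0 else if i \in partB n then inord 1 else inord 2.
have part_inj x y d : d \in balanced_3partite n -> x \in d -> y \in d ->
    part x = part y -> x = y.
  case/balanced_3partiteP=> a [b [c [aA bB cC ->]]].
  have pa : part a = inord 0 by rewrite /part aA.
  have pb : part b = inord 1.
    by rewrite /part bB; case: ifP => //; move: bB; rewrite !inE; lia.
  have pc : part c = inord 2.
    rewrite /part; case: ifP => [|_]; first by move: cC; rewrite !inE; lia.
    by case: ifP => //; move: cC; rewrite !inE; lia.
  by rewrite !inE -!orbA => /or3P[] /eqP-> /or3P[] /eqP-> //;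
    rewrite ?pa ?pb ?pc => /(congr1 val); rewrite /= !inordK.
have /injectivePn[i [j ij eqp]] : ~~ injectiveb (part \o v).
  by apply/injectiveP=> /leq_card; rewrite !card_ord.
have {ij eqp} [i' [j' [ij eqp]]] : exists i' j' : 'I_4, i' < j' /\ part (v i') = part (v j').
  by move: ij; rewrite neq_ltn => /orP[lt|lt]; [exists i, j|exists j, i].
have [eH vie vje] := eP i' j' ij.
by have := vI _ _ (part_inj _ _ _ eH vie vje eqp) => eij; rewrite eij ltnn in ij.
Qed.

Lemma card_balanced_3partite n : #|balanced_3partite n| = f n.
Proof.
have -> : balanced_3partite n = (fun t : 'I_n * 'I_n * 'I_n => [set t.1.1; t.1.2; t.2])
    @: setX (setX (partA n) (partB n)) (partC n).
  apply/setP=> e; apply/idP/imsetP => [/balanced_3partiteP[a [b [c [aA bB cC ->]]]]|].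
    by exists (a, b, c); rewrite // !inE /= ?(aA, bB, cC) //; move: aA bB cC; rewrite !inE => -> -> ->.
  case=> -[[a b] c]; rewrite inE => /andP[]; rewrite inE => /andP[/= aA bB] cC ->.
  rewrite inE; apply/exists_inP; exists a => //; apply/exists_inP; exists b => //.
  by apply/exists_inP; exists c.
rewrite card_in_imset; last first.
  move=> [[a b] c] [[a' b'] c']; rewrite !in_setX /= => /andP[/andP[aA bB] cC].
  move=> /andP[/andP[a'A b'B] c'C] /setP eqs.
  move: aA bB cC a'A b'B c'C; rewrite !inE => aA /andP[b1 b2] cC a'A /andP[b1' b2'] c'C.
  have := eqs a'; have := eqs b'; have := eqs c'; rewrite !inE !eqxx !orbT /= -!(inj_eq val_inj) /=.
  move=> ec eb ea; congr (_, _, _); apply: val_inj => /=; lia.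
have -> : partA n = [set i : 'I_n | 0 <= i < n %/ 3] by [].
have -> : partC n = [set i : 'I_n | n %/ 3 + (n + 1) %/ 3 <= i < n].
  by apply/setP=> i; rewrite !inE ltn_ord andbT.
rewrite !cardsX !card_ord_interval //; try lia.
by rewrite /f; congr (_ * _ * _); lia.
Qed.

(** * The three searches and the theorem *)

Definition checkpoints n (b : nat -> nat) := [seq (size (triples k), b k) | k <- iota 0 n.+1].

(* The bounds come from one triple too many, by iterating
   [b k = ceil ((k.+1 - 3) * b k.+1 / k.+1)]. *)
Lemma refuted6 : refuted 6 (checkpoints 6 (nth 0 [:: 0; 0; 0; 1; 2; 5; 9])).
Proof. by vm_compute. Qed.

Lemma refuted7 : refuted 7 (checkpoints 7 (nth 0 [:: 0; 0; 0; 1; 2; 4; 8; 13])).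
Proof. by vm_compute. Qed.

Lemma refuted8 : refuted 8 (checkpoints 8 (nth 0 [:: 0; 0; 0; 1; 2; 4; 7; 12; 19])).
Proof. by vm_compute. Qed.

Lemma berge_free_le_small n (H : {set {set 'I_n}}) : 6 <= n <= 8 ->
  triple_system H -> berge_free H -> #|H| <= f n.
Proof.
move=> n68 H3 Hfree.
have [n6|[n7|n8]] : n = 6 \/ n = 7 \/ n = 8 by lia.
- subst n; apply: (refuted_le _ H3 Hfree refuted6) => //.
  by case=> [|[|[|[|[|[|k]]]]]] //= c; lia.
- subst n; apply: (refuted_le _ H3 Hfree refuted7) => //.
  by case=> [|[|[|[|[|[|[|k]]]]]]] //= c; lia.
subst n; apply: (refuted_le _ H3 Hfree refuted8) => //.
by case=> [|[|[|[|[|[|[|[|k]]]]]]]] //= c; lia.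
Qed.

Theorem theorem1 (n : nat) (hn : 6 <= n) :
  is_ex3_berge_K4 n (f n) /\ #|balanced_3partite n| = f n.
Proof.
have card := card_balanced_3partite n; split=> //; split.
  exists (balanced_3partite n); split=> //.
    exact: balanced_triple_system.
  exact: balanced_berge_free.
move=> H H3 Hfree; have [n9|n9] := leqP 9 n; first exact: berge_free_le.
by apply: berge_free_le_small; rewrite // hn -ltnS.
Qed.
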